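(* Let $r\in\mathbb{N}$, $n\in\mathbb{N}_0$, $x\in\mathbb{C}$, and $\lambda\in\mathbb{C}$ with $|\lambda|<1$. Then $$\lambda\Phi^{B,r}_{M,\lambda}(-n,x+_M1)-\Phi^{B,r}_{M,\lambda}(-n,x)=-\Phi^{B,r-1}_{M,\lambda}(-n,x)$$ and $$\lambda\Phi^{E,r}_{M,\lambda}(-n,x+_M1)+\Phi^{E,r}_{M,\lambda}(-n,x)=\Phi^{E,r-1}_{M,\lambda}(-n,x).$$ In particular, when $r=1$, writing $\Phi^{B}_{M,\lambda}=\Phi^{B,1}_{M,\lambda}$ and $\Phi^{E}_{M,\lambda}=\Phi^{E,1}_{M,\lambda}$, $$\lambda\Phi^{B}_{M,\lambda}(-n,x+_M1)-\Phi^{B}_{M,\lambda}(-n,x)=-x^n$$ and $$\lambda\Phi^{E}_{M,\lambda}(-n,x+_M1)+\Phi^{E}_{M,\lambda}(-n,x)=x^n.$$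
   Context: $\mathbb{N}=\{1,2,\ldots\}$, $\mathbb{N}_0=\{0,1,2,\ldots\}$. For $n\ge 0$, $M_n=2^n-1$. The M-factorial is $M_0!=1$ and $M_n!=M_nM_{n-1}\cdots M_1$ for $n\geq 1$. The M-binomial coefficient is $\binom{n}{k}_M=\frac{M_n!}{M_k!M_{n-k}!}$ for $0\le k\le n$. The M-exponential is $e_M^{xt}=\sum_{n=0}^{\infty}\frac{x^nt^n}{M_n!}$, and $e_M^t$ denotes the case $x=1$. For $m\in\mathbb{N}_0$ the Mersenne translation polynomials $P_{n,M}(x;m)$ are defined by $e_M^{xt}\left(e_M^t\right)^m=\sum_{n=0}^{\infty}P_{n,M}(x;m)\frac{t^n}{M_n!}$, where $(e_M^t)^m$ is the ordinary $m$-fold product. For $r\in\mathbb{N}$, $n\in\mathbb{N}_0$, $x\in\mathbb{C}$ and $|\lambda|<1$, the Bernoulli-type and Euler-type Mersenne-Lerch interpolation values of order $r$ at $-n$ are the (convergent) series $\Phi^{B,r}_{M,\lambda}(-n,x)=\sum_{m=0}^{\infty}\binom{m+r-1}{m}\lambda^mP_{n,M}(x;m)$ and $\Phi^{E,r}_{M,\lambda}(-n,x)=\sum_{m=0}^{\infty}(-1)^m\binom{m+r-1}{m}\lambda^mP_{n,M}(x;m)$, where $\binom{m+r-1}{m}$ is the ordinary binomial coefficient and $\lambda^0=1$; these are polynomials in $x$. For order zero, by convention $\Phi^{B,0}_{M,\lambda}(-n,x)=\Phi^{E,0}_{M,\lambda}(-n,x)=x^n$ for $n\in\mathbb{N}_0$.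 The M-binomial addition $x+_My$ is a symbolic (umbral) expression determined by $(x+_My)^n=\sum_{k=0}^{n}\binom{n}{k}_Mx^ky^{n-k}$ for $n\ge 0$; for a polynomial $f(x)=\sum_ka_kx^k$, $f(x+_My)$ means $\sum_ka_k(x+_My)^k$ with each $(x+_My)^k$ given by this formula; $x+_M1$ is the case $y=1$. In particular $e_M^{(x+_My)t}=e_M^{xt}e_M^{yt}$. *)

(* Defs.v *)
From HB Require Import structures.
From mathcomp Require Import all_boot all_order all_algebra.
From mathcomp Require Import complex.
From mathcomp Require Import all_classical all_reals all_analysis.

Set Implicit Arguments.
Unset Strict Implicit.
Unset Printing Implicit Defensive.

Import Order.TTheory GRing.Theory Num.Theory.
Import numFieldNormedType.Exports.

Local Open Scope classical_set_scope.
Local Open Scope ring_scope.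

Definition mersenne (n : nat) : nat := (2 ^ n - 1)%N.

Definition Mfact (n : nat) : nat := (\prod_(1 <= k < n.+1) mersenne k)%N.

(* Used for k <= n only: for k > n the subtraction n - k is truncated. *)
Definition Mbinom (K : numFieldType) (n k : nat) : K :=
  (Mfact n)%:R / ((Mfact k)%:R * (Mfact (n - k))%:R).

(* A formal power series in t is represented by its coefficient sequence;
   the multiplication is the Cauchy product. *)
Definition fps (K : numFieldType) := nat -> K.

Definition fps_one (K : numFieldType) : fps K := fun n => (n == 0%N)%:R.

Definition fps_mul (K : numFieldType) (f g : fps K) : fps K :=
  fun n => \sum_(k < n.+1) f k * g (n - k)%N.

Definition fps_pow (K : numFieldType) (f : fps K) (m : nat) : fps K :=
  iter m (fps_mul f) (fps_one K).

(* e_M^{xt} *)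
Definition Mexp (K : numFieldType) (x : K) : fps K :=
  fun n => x ^+ n / (Mfact n)%:R.

(* Mtrans n m x is P_{n,M}(x;m), the coefficient of t^n / M_n! in
   e_M^{xt} (e_M^t)^m. *)
Definition Mtrans (K : numFieldType) (n m : nat) (x : K) : K :=
  (Mfact n)%:R * fps_mul (Mexp x) (fps_pow (Mexp 1) m) n.

(* PhiB r lambda n x and PhiE r lambda n x are the values at -n of the order r
   Bernoulli-type and Euler-type functions. *)
Definition PhiB (K : numFieldType) (r : nat) (lambda : K) (n : nat) (x : K)
    : K :=
  if r == 0%N then x ^+ n else
  limn (series (fun m : nat =>
    'C(m + r - 1, m)%:R * lambda ^+ m * Mtrans n m x)).

Definition PhiE (K : numFieldType) (r : nat) (lambda : K) (n : nat) (x : K)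
    : K :=
  if r == 0%N then x ^+ n else
  limn (series (fun m : nat =>
    (-1) ^+ m * 'C(m + r - 1, m)%:R * lambda ^+ m * Mtrans n m x)).

(* (x +_M y)^n *)
Definition Madd_pow (K : numFieldType) (x y : K) (n : nat) : K :=
  \sum_(k < n.+1) Mbinom K n k * x ^+ k * y ^+ (n - k).

(* The polynomial with values f; unspecified (namely 0) if f is not a
   polynomial function. *)
Definition poly_of_fun (K : numFieldType) (f : K -> K) : {poly K} :=
  xget 0 [set p : {poly K} | forall x, p.[x] = f x].

(* f(x +_M y), for a polynomial function f *)
Definition Msubst (K : numFieldType) (f : K -> K) (x y : K) : K :=
  let p := poly_of_fun f in \sum_(k < size p) p`_k * Madd_pow x y k.

Lemma poly_of_funE (K : numFieldType) (f : K -> K) (p : {poly K}) :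
  (forall x, p.[x] = f x) -> poly_of_fun f = p.
Proof.
move=> pf; rewrite /poly_of_fun; case: xgetP => [q _ qf|/(_ p)//].
apply/eqP; rewrite -subr_eq0; apply/negP => /negP d_neq0.
pose s : seq K := [seq i%:R | i <- iota 0 (size (q - p))].
have s_uniq : uniq s.
  by rewrite map_inj_uniq ?iota_uniq // => i j /eqP; rewrite eqr_nat => /eqP.
have s_root : all (root (q - p)) s.
  by apply/allP => z _; rewrite /root hornerD hornerN qf pf subrr.
by have := max_poly_roots d_neq0 s_root s_uniq; rewrite size_map size_iota ltnn.
Qed.

Lemma Msubst_horner (K : numFieldType) (p : {poly K}) (x y : K) :
  Msubst (horner p) x y = \sum_(k < size p) p`_k * Madd_pow x y k.
Proof. by rewrite /Msubst (@poly_of_funE _ _ p). Qed.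

(* Main.v *)
Require Import Defs.
From mathcomp Require Import all_boot all_order all_algebra.
From mathcomp Require Import complex ring.
From mathcomp Require Import all_classical all_reals all_analysis.

(** The formal idea: summing over m, the generating function in t of the values
    Phi^{B,r}(-n, x) is
      sum_m C(m+r-1, m) lambda^m e^{xt} (e^t)^m = e^{xt} / (1 - lambda e^t)^r,
    where e is the M-exponential.  Multiplying by 1 - lambda e^t lowers r by
    one, and multiplying by e^t is the substitution x -> x +_M 1, because
    e^{(x +_M 1)t} = e^{xt} e^t.  The Euler case is the Bernoulli case at
    - lambda.

    The argument works coefficientwise in t.  Pascal's rule for C(m+r-1, m)
    turns multiplication by 1 - lambda e^t into a recurrence in m between the
    terms of orders r + 1 and r (lerch_term_rec); summing it over m gives
    lerch_gf_rec.

    Convergence comes from the same recurrence.  Isolating the coefficient 1 of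
    t^0 in e^t, the terms v_m of the series for (r + 1, n) satisfy
    v_{m+1} = lambda v_m + e_m, where e_m combines terms for (r + 1, k) with
    k < n and for (r, n).  By induction on r and then n the series of e is
    summable, and then so is that of v, with an explicit sum
    (has_sum_affine_rec).

    Finally, the sum factors as e^{xt} times a series free of x (lerch_gf_Mexp).
    Hence Phi^{B,r}(-n, x) is a polynomial in x, and its umbral translate by 1
    is computed by Msubst_Mexp_mul. *)

Import Order.TTheory GRing.Theory Num.Theory.
Import numFieldNormedType.Exports.

Local Open Scope ring_scope.
Local Open Scope complex_scope.

Set Implicit Arguments.
Unset Strict Implicit.
Unset Printing Implicit Defensive.

(** * Summable sequences *)

(** The form of `|lambda| < 1 that has analytic force over any numFieldType:
    without the archimedean property an element of norm below 1 may have powers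
    that do not tend to 0. *)
Definition null_powers (K : numFieldType) (lambda : K) : Prop :=
  ((fun m => lambda ^+ m) @ \oo --> (0 : K))%classic.

Definition has_sum (K : numFieldType) (u : nat -> K) (l : K) : Prop :=
  (series u @ \oo --> l)%classic.

Lemma limn_has_sum (K : numFieldType) (u : nat -> K) (l : K) :
  has_sum u l -> limn (series u) = l.
Proof. by move=> ul; apply: cvg_lim ul; apply: norm_hausdorff. Qed.

Lemma has_sum_unique (K : numFieldType) (u : nat -> K) (l l' : K) :
  has_sum u l -> has_sum u l' -> l = l'.
Proof. by move=> /limn_has_sum <- /limn_has_sum. Qed.

Lemma has_sum0 (K : numFieldType) : has_sum (fun=> 0 : K) 0.
Proof.
rewrite /has_sum /series /=; under eq_fun do rewrite big1 //.
exact: cvg_cst.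
Qed.

Lemma has_sumD (K : numFieldType) (u v : nat -> K) (a b : K) :
  has_sum u a -> has_sum v b -> has_sum (fun m => u m + v m) (a + b).
Proof.
move=> ua vb; rewrite /has_sum /series /=.
under eq_fun do rewrite big_split /=.
exact: cvgD ua vb.
Qed.

Lemma has_sumZ (K : numFieldType) (c : K) (u : nat -> K) (a : K) :
  has_sum u a -> has_sum (fun m => c * u m) (c * a).
Proof.
move=> ua; rewrite /has_sum /series /=.
under eq_fun do rewrite -big_distrr /=.
exact: cvgMl_tmp ua.
Qed.

Arguments has_sumZ {K} c {u a} _.

Lemma has_sum_sum (K : numFieldType) (I : Type) (s : seq I)
    (u : I -> nat -> K) (a : I -> K) :
  (forall i, has_sum (u i) (a i)) ->
  has_sum (fun m => \sum_(i <- s) u i m) (\sum_(i <- s) a i).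
Proof.
move=> ua; elim: s => [|i s IHs].
  by under eq_fun do rewrite big_nil; rewrite big_nil; apply: has_sum0.
under eq_fun do rewrite big_cons; rewrite big_cons.
exact: has_sumD.
Qed.

Lemma has_sum_shift (K : numFieldType) (u : nat -> K) (a : K) :
  has_sum (fun m => u m.+1) a <-> has_sum u (u 0%N + a).
Proof.
have serS N : series u N.+1 = u 0%N + series (fun m => u m.+1) N.
  by rewrite /series /= big_nat_recl.
have serS' N : series (fun m => u m.+1) N = series u N.+1 - u 0%N.
  by rewrite serS addrC addKr.
split=> ua; rewrite /has_sum.
  rewrite -(cvg_shiftS (series u)) /=; under eq_fun do rewrite serS.
  by apply: cvgD; [exact: cvg_cst | exact: ua].
rewrite (funext serS').
have -> : a = u 0%N + a - u 0%N by rewrite addrC addKr.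
apply: cvgB; last exact: cvg_cst.
by move: ua; rewrite /has_sum -(cvg_shiftS (series u)).
Qed.

(** Norms and positive tolerances in R[i] are real, so the claim reduces to the
    real geometric sequence of ratio `|lambda|. *)
Lemma cvg_expr_complex (R : realType) (lambda : R[i]) :
  `|lambda| < 1 -> null_powers lambda.
Proof.
move=> lam_lt1; apply/cvgr0Pnorm_lt => eps eps_gt0.
have /complex_realP[e eE] : eps \is Num.real by rewrite gtr0_real.
have /complex_realP[q qE] : `|lambda| \is Num.real by rewrite normr_real.
have q_ge0 : 0 <= q by rewrite -lecR -qE normr_ge0.
have : `|q| < 1 by rewrite ger0_norm // -ltcR -qE.
move=> /cvg_expr/cvgr0Pnorm_lt/(_ e).
rewrite -ltcR -eE => /(_ eps_gt0)[N _ qN]; exists N => // m /qN /=.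
by rewrite normrX ger0_norm // normrX qE -rmorphXn /= eE ltcR.
Qed.

(** * First-order recurrences *)

Lemma norm_lt1_of_cvg_expr (K : numFieldType) (lambda : K) :
  null_powers lambda -> `|lambda| < 1.
Proof.
move=> /cvgr0Pnorm_lt /(_ 1 ltr01) [N _ /(_ N (leqnn N))] /=.
rewrite normrX; apply: contraTT; rewrite -!real_leNgt ?rpredX ?normr_real //.
exact: exprn_ege1.
Qed.

(** The constant c is the fixed point of y |-> `|lambda| y + c (1 - `|lambda|),
    which majorises the recurrence, so the distance to c is only transported by
    powers of lambda. *)
Lemma norm_affine_rec_le (K : numFieldType) (lambda c : K) (v e : nat -> K) :
  0 <= c -> (forall m, v m.+1 = lambda * v m + e m) ->
  (forall m, `|e m| <= c * (1 - `|lambda|)) ->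
  forall m, `|v m| <= `|lambda ^+ m * v 0%N| + c.
Proof.
move=> c_ge0 vS e_le m.
suff : `|v m| <= `|lambda ^+ m * v 0%N| + c * (1 - `|lambda| ^+ m).
  by move/le_trans; apply; rewrite lerD2l ler_piMr // gerBl exprn_ge0.
elim: m => [|m IHm]; first by rewrite !expr0 mul1r subrr mulr0 addr0.
rewrite vS (le_trans (ler_normD _ _)) //.
apply: le_trans (lerD _ (e_le m)) _.
  by rewrite normrM; apply: ler_wpM2l IHm; rewrite normr_ge0.
rewrite exprS -mulrA [in leRHS]normrM exprS le_eqVlt; apply/orP; left.
by apply/eqP; ring.
Qed.

(** Past a rank N the forcing term is small enough for norm_affine_rec_le to
    leave only eps / 2 and the homogeneous part lambda ^+ k * v N, which is
    null. *)
Lemma cvg0_affine_rec (K : numFieldType) (lambda : K) (v e : nat -> K) :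
  null_powers lambda ->
  (forall m, v m.+1 = lambda * v m + e m) ->
  (e @ \oo --> (0 : K))%classic -> (v @ \oo --> (0 : K))%classic.
Proof.
move=> lam0 vS e0; have lam_lt1 := norm_lt1_of_cvg_expr lam0.
have gap_gt0 : 0 < 1 - `|lambda| by rewrite subr_gt0.
apply/cvgr0Pnorm_le => eps eps_gt0.
have eps2_gt0 : 0 < eps / 2 by rewrite divr_gt0.
have /cvgr0Pnorm_le/(_ _ (mulr_gt0 eps2_gt0 gap_gt0))[N _ eN] := e0.
have tail k : `|v (N + k)%N| <= `|lambda ^+ k * v N| + eps / 2.
  have vNS m : v (N + m.+1)%N = lambda * v (N + m)%N + e (N + m)%N.
    by rewrite addnS vS.
  have eN_le m : `|e (N + m)%N| <= eps / 2 * (1 - `|lambda|).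
    by apply: eN; apply: leq_addr.
  by have := norm_affine_rec_le (ltW eps2_gt0) vNS eN_le k; rewrite addn0.
have : ((fun k => lambda ^+ k * v N) @ \oo --> (0 : K))%classic.
  by rewrite -(mul0r (v N)); apply: cvgMr_tmp.
move=> /cvgr0Pnorm_le/(_ _ eps2_gt0)[N' _ homN'].
exists (N + N')%N => // m /= leNm.
have leNm' : (N <= m)%N := leq_trans (leq_addr _ _) leNm.
have leN'm : (N' <= m - N)%N by rewrite leq_subRL.
rewrite -(subnKC leNm').
apply: le_trans (tail _) _.
by rewrite [leRHS]splitr lerD2r; apply: homN'.
Qed.

(** Adding up the recurrence over m < N gives
    (1 - lambda) (v_0 + ... + v_{N-1}) = v_0 + (e_0 + ... + e_{N-1}) - v_N,
    and v_N tends to 0. *)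
Lemma has_sum_affine_rec (K : numFieldType) (lambda : K) (v e : nat -> K)
    (b : K) :
  null_powers lambda ->
  (forall m, v m.+1 = lambda * v m + e m) ->
  has_sum e b -> has_sum v ((v 0%N + b) / (1 - lambda)).
Proof.
move=> lam0 vS eb.
have gap_neq0 : 1 - lambda != 0.
  rewrite subr_eq0; apply/eqP => lam1.
  by have := norm_lt1_of_cvg_expr lam0; rewrite -lam1 normr1 ltxx.
have v0 : (v @ \oo --> (0 : K))%classic.
  apply: cvg0_affine_rec lam0 vS _.
  by apply: cvg_series_cvg_0; apply/cvg_ex; exists b.
have serE N : series v N = (v 0%N + series e N - v N) / (1 - lambda).
  apply: (mulIf gap_neq0); rewrite divfK //.
  rewrite /series /=; elim: N => [|N IHN].
    by rewrite !big_geq // addr0 subrr mul0r.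
  by rewrite !big_nat_recr //= mulrDl IHN vS; ring.
rewrite /has_sum (funext serE).
apply: cvgMr_tmp; rewrite -[_ + b]subr0; apply: cvgB v0.
by apply: cvgD; [exact: cvg_cst | exact: eb].
Qed.

(** * The ring laws of formal power series *)

(** Truncating to polynomials transports commutativity and associativity from
    {poly K}, which avoids reindexing double sums. *)
Lemma fps_mul_coefM (K : numFieldType) (f g : fps K) (N n : nat) :
  (n < N)%N ->
  fps_mul f g n = ((\poly_(i < N) f i) * (\poly_(i < N) g i))`_n.
Proof.
move=> ltnN; rewrite coefM; apply: eq_bigr => k _; rewrite !coef_poly.
have -> : (k < N)%N by apply: leq_ltn_trans ltnN; rewrite -ltnS.
by rewrite (leq_ltn_trans (leq_subr _ _) ltnN).
Qed.

Lemma fps_mulC (K : numFieldType) (f g : fps K) : fps_mul f g = fps_mul g f.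
Proof. by apply/funext => n; rewrite !(@fps_mul_coefM _ _ _ n.+1) // mulrC. Qed.

Lemma eq_coefM (K : numFieldType) (p p' q q' : {poly K}) (n : nat) :
  (forall k, (k <= n)%N -> p`_k = p'`_k) ->
  (forall k, (k <= n)%N -> q`_k = q'`_k) -> (p * q)`_n = (p' * q')`_n.
Proof.
move=> pp' qq'; rewrite !coefM; apply: eq_bigr => k _.
by rewrite pp' ?qq' ?leq_subr // -ltnS.
Qed.

Lemma fps_mulA (K : numFieldType) (f g h : fps K) :
  fps_mul f (fps_mul g h) = fps_mul (fps_mul f g) h.
Proof.
apply/funext => n; rewrite !(@fps_mul_coefM _ _ _ n.+1) //.
set P := fun f : fps K => \poly_(i < n.+1) f i; rewrite -!/(P _).
have PM f1 f2 k : (k <= n)%N -> (P (fps_mul f1 f2))`_k = (P f1 * P f2)`_k.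
  by move=> lekn; rewrite coef_poly ltnS lekn (@fps_mul_coefM _ _ _ n.+1).
transitivity ((P f * (P g * P h))`_n); first exact: eq_coefM (PM g h).
by rewrite mulrA; apply: eq_coefM => // k lekn; rewrite PM.
Qed.

Lemma fps_mul1 (K : numFieldType) (f : fps K) : fps_mul (fps_one K) f = f.
Proof.
apply/funext => n; rewrite /fps_mul big_ord_recl /fps_one eqxx mul1r subn0.
by rewrite big1 ?addr0 // => k _; rewrite mul0r.
Qed.

(** * M-exponentials and umbral translation *)

Lemma Mfact_neq0 (K : numFieldType) (n : nat) : (Mfact n)%:R != 0 :> K.
Proof.
rewrite pnatr_eq0 -lt0n /Mfact big_add1 /=.
apply: prodn_cond_gt0 => k _; rewrite /mersenne subn_gt0.
by rewrite -[X in (X < _)%N](expn0 2) ltn_exp2l.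
Qed.

Lemma Mexp0 (K : numFieldType) : Mexp (0 : K) = fps_one K.
Proof.
apply/funext => -[|n]; rewrite /Mexp /fps_one; last by rewrite expr0n mul0r.
by rewrite /Mfact big_geq // divr1.
Qed.

Lemma Madd_pow_fps (K : numFieldType) (x y : K) (n : nat) :
  Madd_pow x y n = (Mfact n)%:R * fps_mul (Mexp x) (Mexp y) n.
Proof.
rewrite /Madd_pow /fps_mul big_distrr /=; apply: eq_bigr => k _.
by rewrite /Mbinom /Mexp; field; rewrite !Mfact_neq0.
Qed.

(** Umbral translation by y multiplies the generating function by e_M^{yt}.
    Msubst takes the coefficients of the polynomial function it is given; here
    the product defining fps_mul (Mexp z) b n is already an expansion in powers
    of z. *)
Lemma Msubst_Mexp_mul (K : numFieldType) (b : fps K) (n : nat) (x y : K) :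
  Msubst (fun z => (Mfact n)%:R * fps_mul (Mexp z) b n) x y
    = (Mfact n)%:R * fps_mul (Mexp y) (fps_mul (Mexp x) b) n.
Proof.
pose E k := (Mfact n)%:R / (Mfact k)%:R * b (n - k)%N.
pose p := \poly_(k < n.+1) E k.
have -> : (fun z => (Mfact n)%:R * fps_mul (Mexp z) b n) = horner p.
  apply/funext => z; rewrite horner_poly /fps_mul big_distrr /=.
  by apply: eq_bigr => k _; rewrite /E /Mexp; field; rewrite Mfact_neq0.
(* The sum defining Msubst stops at the size of p, which may be less than
   n + 1, as when b vanishes at 0. *)
rewrite Msubst_horner (big_ord_widen n.+1 (fun k => p`_k * Madd_pow x y k));
  last exact: size_poly.
rewrite [LHS]big_mkcond /= fps_mulA (fps_mulC (Mexp y)).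
rewrite [in RHS]/fps_mul big_distrr /=.
apply: eq_bigr => k _.
have -> : (if (k < size p)%N then p`_k * Madd_pow x y k else 0)
    = p`_k * Madd_pow x y k.
  by case: ltnP => // lepk; rewrite nth_default ?mul0r.
rewrite coef_poly ltn_ord Madd_pow_fps /E.
by rewrite -/(fps_mul (Mexp x) (Mexp y) k); field; rewrite Mfact_neq0.
Qed.

(** * Mersenne-Lerch sums and their recurrence in the order *)

(** The normalisation by M_n! is left out, so that recurrences become products
    of power series in t.  For r = 0 the truncated m + r - 1 makes the weight
    vanish except at m = 0, so order zero is no exception. *)
Definition lerch_term (K : numFieldType) (r : nat) (lambda x : K) (n m : nat)
    : K :=
  'C(m + r - 1, m)%:R * lambda ^+ m
    * fps_mul (Mexp x) (fps_pow (Mexp 1) m) n.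

Definition lerch_gf (K : numFieldType) (r : nat) (lambda x : K) : fps K :=
  fun n => limn (series (lerch_term r lambda x n)).

Lemma lerch_term0 (K : numFieldType) (r : nat) (lambda x : K) (n : nat) :
  lerch_term r lambda x n 0 = Mexp x n.
Proof. by rewrite /lerch_term bin0 expr0 !mul1r fps_mulC fps_mul1. Qed.

Lemma lerch_term_order0 (K : numFieldType) (lambda x : K) (n m : nat) :
  lerch_term 0 lambda x n m.+1 = 0.
Proof. by rewrite /lerch_term bin_small ?mul0r // addn0 subn1. Qed.

(** Pascal's rule C(m+r+1, m+1) = C(m+r, m) + C(m+r, m+1): the first part
    rebuilds the order r + 1 terms at m, multiplied by lambda e_M^t, and the
    second part is the term of order r. *)
Lemma lerch_term_rec (K : numFieldType) (r : nat) (lambda x : K) (n m : nat) :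
  lerch_term r.+1 lambda x n m.+1
    = lambda * fps_mul (Mexp 1) (fun k => lerch_term r.+1 lambda x k m) n
      + lerch_term r lambda x n m.+1.
Proof.
rewrite /lerch_term !addnS !addSn !subn1 /= binS natrD.
have -> : fps_mul (Mexp x) (fps_pow (Mexp 1) m.+1)
    = fps_mul (Mexp 1) (fps_mul (Mexp x) (fps_pow (Mexp 1) m)).
  by rewrite [fps_pow _ _]/= fps_mulA (fps_mulC (Mexp x)) -fps_mulA.
set F := fps_mul (Mexp x) _.
have -> : fps_mul (Mexp 1) (fun k => 'C(m + r, m)%:R * lambda ^+ m * F k) n
    = 'C(m + r, m)%:R * lambda ^+ m * fps_mul (Mexp 1) F n.
  by rewrite /fps_mul big_distrr /=; apply: eq_bigr => k _; ring.
by rewrite exprS; ring.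
Qed.

(** The variable x enters only through the factor e_M^{xt}, and e_M^{0t} = 1. *)
Lemma lerch_term_Mexp (K : numFieldType) (r : nat) (lambda x : K) (n m : nat) :
  lerch_term r lambda x n m
    = fps_mul (Mexp x) (fun k => lerch_term r lambda 0 k m) n.
Proof.
rewrite /lerch_term Mexp0 fps_mul1 /fps_mul big_distrr /=.
by apply: eq_bigr => k _; ring.
Qed.

Lemma has_sum_fps_mul (K : numFieldType) (f : fps K) (u : nat -> nat -> K)
    (a : fps K) (n : nat) :
  (forall k, has_sum (u k) (a k)) ->
  has_sum (fun m => fps_mul f (u^~ m) n) (fps_mul f a n).
Proof.
by move=> ua; apply: has_sum_sum => k; apply: has_sumZ.
Qed.

(** Convergence is proved by induction on r, then strongly on n: the t^0
    coefficient of e_M^t is 1, so lerch_term_rec is a first-order recurrence in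
    m whose forcing term involves only order r, or order r + 1 below n. *)
Lemma has_sum_lerch_gf (K : numFieldType) (lambda x : K) (r n : nat) :
  null_powers lambda ->
  has_sum (lerch_term r lambda x n) (lerch_gf r lambda x n).
Proof.
move=> lam0; suff cvg_term : exists s, has_sum (lerch_term r lambda x n) s.
  by case: cvg_term => s s_sum; rewrite /lerch_gf (limn_has_sum s_sum).
elim: r n => [|r IHr] n.
  exists (lerch_term 0 lambda x n 0 + 0); apply/has_sum_shift.
  by rewrite (funext (lerch_term_order0 lambda x n)); apply: has_sum0.
elim/ltn_ind: n => n IHn.
have /choice[s s_sum] k : exists s, (k < n)%N ->
    has_sum (lerch_term r.+1 lambda x k) s.
  by case: (ltnP k n) => [/IHn[s ?]|_]; [exists s | exists 0].
have [t t_sum] := IHr n.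
(* The index k = 0 of the product is the homogeneous part; lift ord0 runs
   over the others. *)
have e_sum : has_sum (fun m =>
    lambda * (\sum_(k < n) Mexp 1 (lift ord0 k)
                * lerch_term r.+1 lambda x (n - lift ord0 k)%N m)
    + lerch_term r lambda x n m.+1)
  (lambda * (\sum_(k < n) Mexp 1 (lift ord0 k) * s (n - lift ord0 k)%N)
    + (t - lerch_term r lambda x n 0)).
  apply: has_sumD; last by apply/has_sum_shift; rewrite addrC subrK.
  apply: has_sumZ; apply: has_sum_sum => k; apply: has_sumZ.
  by apply: s_sum; rewrite ltn_subrL lift0 /= (leq_ltn_trans _ (ltn_ord k)).
eexists; apply: has_sum_affine_rec lam0 _ e_sum => m.
rewrite lerch_term_rec [fps_mul _ _ _]big_ord_recl subn0.
rewrite [Mexp 1 _](_ : _ = 1); first by ring.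
by rewrite /Mexp expr0 /Mfact big_geq // divr1.
Qed.

Arguments has_sum_lerch_gf {K lambda} x r n _.

(** The recurrence in m says nothing about m = 0, but there the terms of all
    orders agree, so summation yields (1 - lambda e_M^t) G_{r+1} = G_r without a
    boundary term. *)
Lemma lerch_gf_rec (K : numFieldType) (lambda x : K) (r n : nat) :
  null_powers lambda ->
  lerch_gf r.+1 lambda x n
    = lambda * fps_mul (Mexp 1) (lerch_gf r.+1 lambda x) n
      + lerch_gf r lambda x n.
Proof.
move=> lam0; have sum_gf r' k := has_sum_lerch_gf x r' k lam0.
apply: has_sum_unique (sum_gf _ _) _.
rewrite -[lerch_gf r lambda x n](subrK (lerch_term r lambda x n 0)) addrA addrC.
rewrite [in X in X + _]lerch_term0 -(lerch_term0 r.+1 lambda x n).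
apply/has_sum_shift; rewrite (funext (lerch_term_rec r lambda x n)).
apply: has_sumD; last by apply/has_sum_shift; rewrite addrC subrK.
by apply: has_sumZ; apply: has_sum_fps_mul => k; apply: sum_gf.
Qed.

Lemma lerch_gf_Mexp (K : numFieldType) (lambda x : K) (r n : nat) :
  null_powers lambda ->
  lerch_gf r lambda x n = fps_mul (Mexp x) (lerch_gf r lambda 0) n.
Proof.
move=> lam0; apply: has_sum_unique (has_sum_lerch_gf x r n lam0) _.
rewrite (funext (lerch_term_Mexp r lambda x n)).
by apply: has_sum_fps_mul => k; apply: has_sum_lerch_gf.
Qed.

Lemma PhiB_lerch_gf (K : numFieldType) (lambda x : K) (r n : nat) :
  null_powers lambda ->
  PhiB r lambda n x = (Mfact n)%:R * lerch_gf r lambda x n.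
Proof.
move=> lam0; rewrite /PhiB; case: eqP => [->|_].
  rewrite /lerch_gf (@limn_has_sum _ _ (lerch_term 0 lambda x n 0 + 0)).
    by rewrite addr0 lerch_term0 /Mexp mulrC divfK ?Mfact_neq0.
  apply/has_sum_shift.
  by rewrite (funext (lerch_term_order0 lambda x n)); apply: has_sum0.
rewrite -(limn_has_sum (has_sumZ (Mfact n)%:R (has_sum_lerch_gf x r n lam0))).
congr (limn (series _)); apply/funext => m.
by rewrite /lerch_term /Mtrans; ring.
Qed.

Lemma PhiE_PhiB (K : numFieldType) (r : nat) (lambda : K) (n : nat) :
  PhiE r lambda n = PhiB r (- lambda) n.
Proof.
apply/funext => x; rewrite /PhiE /PhiB; case: eqP => // _.
congr (limn (series _)); apply/funext => m.
by rewrite [(- lambda) ^+ m]exprNn; ring.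
Qed.

(** * The recurrence for the interpolation values *)

Lemma PhiB_rec (K : numFieldType) (lambda x : K) (r n : nat) :
  null_powers lambda ->
  PhiB r.+1 lambda n x
    = lambda * Msubst (PhiB r.+1 lambda n) x 1 + PhiB r lambda n x.
Proof.
move=> lam0.
have -> : PhiB r.+1 lambda n
    = fun z => (Mfact n)%:R * fps_mul (Mexp z) (lerch_gf r.+1 lambda 0) n.
  by apply/funext => z; rewrite PhiB_lerch_gf // lerch_gf_Mexp.
rewrite Msubst_Mexp_mul PhiB_lerch_gf // -lerch_gf_Mexp //.
have <- : lerch_gf r.+1 lambda x = fps_mul (Mexp x) (lerch_gf r.+1 lambda 0).
  by apply/funext => k; rewrite lerch_gf_Mexp.
by rewrite lerch_gf_rec //; ring.
Qed.

Theorem theorem7p4 (R : realType) (r n : nat) (x lambda : R[i])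
    (hr : (1 <= r)%N) (hlambda : `|lambda| < 1) :
  (lambda * Msubst (PhiB r lambda n) x 1 - PhiB r lambda n x
     = - PhiB (r - 1) lambda n x /\
   lambda * Msubst (PhiE r lambda n) x 1 + PhiE r lambda n x
     = PhiE (r - 1) lambda n x) /\
  (lambda * Msubst (PhiB 1 lambda n) x 1 - PhiB 1 lambda n x = - x ^+ n /\
   lambda * Msubst (PhiE 1 lambda n) x 1 + PhiE 1 lambda n x = x ^+ n).
Proof.
have lam0 := cvg_expr_complex hlambda.
have lamN0 : null_powers (- lambda).
  by apply: cvg_expr_complex; rewrite normrN.
have Phi_rec k : (1 <= k)%N ->
    lambda * Msubst (PhiB k lambda n) x 1 - PhiB k lambda n x
      = - PhiB (k - 1) lambda n x /\
    lambda * Msubst (PhiE k lambda n) x 1 + PhiE k lambda n x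
      = PhiE (k - 1) lambda n x.
  case: k => // k _; rewrite subn1 !PhiE_PhiB /=.
  by rewrite (PhiB_rec x k n lam0) (PhiB_rec x k n lamN0); split; ring.
by split; apply: Phi_rec.
Qed.
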